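(* Let $\gamma$ be a composition of $n$. The set $\{\mathbf{R}_\alpha^{(\gamma)}(A;t)\}_{\alpha\le\gamma}$ is a basis of $\mathbf{Sym}^{(\gamma)}$. For every composition $\alpha\le\gamma$, the change of basis between Hall-Littlewood functions and $\gamma$-ribbon Schur functions is given by $$\mathbf{H}_{\alpha}(A;t)=\sum_{\alpha\le\beta\le\gamma}t^{c(\alpha,\beta^c)}\,\mathbf{R}^{(\gamma)}_\beta(A;t),$$ and the inverse change of basis is given by $$\mathbf{R}^{(\gamma)}_\alpha(A;t)=\sum_{\alpha\le\beta\le\gamma}(-1)^{l(\alpha)-l(\beta)}\,t^{c(\alpha,\beta^{c})}\,\mathbf{H}_\beta(A;t).$$
   Context: A composition $\alpha=(\alpha_1,\ldots,\alpha_{l(\alpha)})$ of $n$ (written $\alpha\models n$) is a sequence of positive integers with sum $n$; $l(\alpha)$ is its length. Its descent set is $D(\alpha)=\{\alpha_1,\alpha_1+\alpha_2,\ldots,\alpha_1+\cdots+\alpha_{l(\alpha)-1}\}\subseteq\{1,\ldots,n-1\}$; this gives a bijection between compositions of $n$ and subsets of $\{1,\ldots,n-1\}$. Refinement order on compositions of $n$: $\alpha\le\beta$ iff $D(\beta)\subseteq D(\alpha)$. The complement $\alpha^c$ is the composition of $n$ with $D(\alpha^c)=\{1,\ldots,n-1\}\setminus D(\alpha)$. For compositions $\alpha,\beta$ of $n$, $c(\alpha,\beta)=\sum_{i\in D(\alpha)\cap D(\beta)}i$. $\mathbf{Sym}=\mathbb{C}(q,t)\langle\mathbf{h}_1,\mathbf{h}_2,\ldots\rangle$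 is the free associative algebra of non-commutative symmetric functions; $\mathbf{h}_\alpha(A)=\mathbf{h}_{\alpha_1}\cdots\mathbf{h}_{\alpha_{l(\alpha)}}$. The ribbon Schur functions are $\mathbf{R}_\alpha(A)=\sum_{\beta\ge\alpha}(-1)^{l(\alpha)-l(\beta)}\mathbf{h}_\beta(A)$. Non-commutative Hall-Littlewood functions: $\mathbf{H}_\alpha(A;t)=\sum_{\beta\ge\alpha}t^{c(\alpha,\beta^c)}\mathbf{R}_\beta(A)$. For a composition $\gamma$ of $n$, $\mathbf{Sym}^{(\gamma)}$ is the linear span of $\{\mathbf{H}_\alpha(A;t):\alpha\models n,\ \alpha\le\gamma\}$. For compositions $\alpha\le\gamma$ of $n$, the $\gamma$-ribbon Schur function (also called $\gamma$-Schur function) is $$\mathbf{R}_\alpha^{(\gamma)}(A;t)=\sum_{\substack{\beta\ge\alpha\\ D(\alpha)\setminus D(\beta)\subseteq D(\gamma)}}t^{c(\alpha,\beta^c)}\mathbf{R}_\beta(A).$$ *)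

(* Defs.v *)
From HB Require Import structures.
From mathcomp Require Import all_boot all_order all_algebra.
From mathcomp Require Import reals complex fraction monalg.

Set Implicit Arguments.
Unset Strict Implicit.
Unset Printing Implicit Defensive.

Import GRing.Theory.

Local Open Scope ring_scope.

Record composition (n : nat) : predArgType := Composition {
  parts :> seq nat;
  _ : all (ltn 0%N) parts && (sumn parts == n)
}.

HB.instance Definition _ n := [isSub for @parts n].
HB.instance Definition _ n := [Countable of composition n by <:].

Definition composition_enum n : seq (composition n) :=
  pmap insub (undup [seq [seq val i | i <- s] | s : {bseq n of 'I_n.+1}]).

Lemma composition_enumP n : Finite.axiom (@composition_enum n).
Proof.
apply: Finite.uniq_enumP; first by rewrite pmap_sub_uniq ?undup_uniq.
move=> [s sP]; rewrite mem_pmap_sub inE /= mem_undup.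
have /andP[/allP s_gt0 /eqP sn] := sP.
have le_n : {in s, forall i, (i <= n)%N}.
  by move=> i si; rewrite -sn; elim: (s) si {s_gt0 sn sP} => //= j r IHr;
    rewrite inE => /predU1P[->|/IHr]; [exact: leq_addr | move/leq_trans; apply; exact: leq_addl].
have le_size : (size [seq (inord i : 'I_n.+1) | i <- s] <= n)%N.
  rewrite size_map -sn; elim: (s) s_gt0 {sn sP le_n} => //= j r IHr s_gt0.
  rewrite -add1n leq_add ?s_gt0 ?mem_head //.
  by apply: IHr => i ri; apply: s_gt0; rewrite inE ri orbT.
apply/mapP; exists (Bseq le_size); rewrite ?mem_enum //=.
by rewrite -map_comp map_id_in // => i /le_n ? /=; rewrite inordK.
Qed.

HB.instance Definition _ n := isFinite.Build (composition n) (@composition_enumP n).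

Section Compositions.
Variable n : nat.
Implicit Types (a b g : composition n) (S : {set 'I_n}).

(* scanl lists the nonempty partial sums; the last one, n, is left out *)
(* because i ranges over 'I_n.                                         *)
Definition descents a : {set 'I_n} :=
  [set i : 'I_n | (i : nat) \in scanl addn 0%N a].

Definition cuts S : seq nat :=
  rcons [seq i <- iota 1 n.-1 | i \in [seq val j | j in S]] n.

(* The filter only matters for n = 0, where the single cut 0 must give the *)
(* empty composition.                                                      *)
Definition gaps S : seq nat :=
  [seq d <- pairmap (fun i j => (j - i)%N) 0%N (cuts S) | (0 < d)%N].

Lemma cuts_path S : (0 < n)%N -> path ltn 0%N (cuts S).
Proof.
move=> n_gt0; rewrite rcons_path; apply/andP; split.
  apply: path_filter; first exact: ltn_trans.
  by have := iota_ltn_sorted 0 n; rewrite -[X in iota 0 X](prednK n_gt0).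
have: all (ltn^~ n) (0%N :: [seq i <- iota 1 n.-1 | i \in [seq val j | j in S]]).
  rewrite /= n_gt0; apply/allP => i; rewrite mem_filter mem_iota => /andP[_].
  by rewrite add1n prednK // => /andP[].
by move/allP; apply; exact: mem_last.
Qed.

Lemma mem_cuts S (i : 'I_n) : ((i : nat) \in cuts S) = (0 < i)%N && (i \in S).
Proof.
have n_gt0 : (0 < n)%N by apply: leq_ltn_trans (ltn_ord i).
rewrite mem_rcons inE ltn_eqF //= mem_filter mem_iota add1n prednK // ltn_ord.
by rewrite andbT andbC (mem_image val_inj).
Qed.

Lemma pairmap_sub_gt0 x s :
  path ltn x s -> all (ltn 0%N) (pairmap (fun i j => (j - i)%N) x s).
Proof. by elim: s x => //= y s IHs x /andP[xy /IHs ->]; rewrite subn_gt0 xy. Qed.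

Lemma scanl_pairmap_sub x s :
  path ltn x s -> scanl addn x (pairmap (fun i j => (j - i)%N) x s) = s.
Proof.
by elim: s x => //= y s IHs x /andP[xy /IHs]; rewrite (subnKC (ltnW xy)) => ->.
Qed.

Lemma sumn_pairmap_sub x s : path ltn x s ->
  (x + sumn (pairmap (fun i j => (j - i)%N) x s) = last x s)%N.
Proof.
elim: s x => [|y s IHs] x /=; first by rewrite addn0.
by case/andP=> xy /IHs <-; rewrite addnA (subnKC (ltnW xy)).
Qed.

Lemma gapsE S : (0 < n)%N ->
  gaps S = pairmap (fun i j => (j - i)%N) 0%N (cuts S).
Proof. by move=> n0; apply/all_filterP/pairmap_sub_gt0/cuts_path. Qed.

Lemma gapsP S : all (ltn 0%N) (gaps S) && (sumn (gaps S) == n).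
Proof.
rewrite filter_all /=; have [n0|n_gt0] := posnP n.
  suff: cuts S = [:: 0%N]; last first.
    by rewrite /cuts; case: n n0 S => // ? S.
  by rewrite /gaps => ->; rewrite /= n0.
rewrite gapsE // -[sumn _]add0n sumn_pairmap_sub ?cuts_path //.
by rewrite last_rcons.
Qed.

Definition of_descents S : composition n := Composition (gapsP S).

Lemma of_descentsK S : descents (of_descents S) = [set i in S | (0 < i)%N].
Proof.
apply/setP => i; have n_gt0 : (0 < n)%N by apply: leq_ltn_trans (ltn_ord i).
rewrite !inE /= gapsE // scanl_pairmap_sub ?cuts_path //.
by rewrite mem_cuts andbC.
Qed.

Lemma descentsK : cancel descents of_descents.
Proof.
move=> a; apply/val_inj => /=; have /andP[a_gt0 /eqP sum_a] := valP a.
have [n0|n_gt0] := posnP n.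
  have -> : val a = [::].
    by case: (val a) a_gt0 sum_a => //= j r /andP[j0 _]; rewrite n0; case: j j0.
  have /andP[] := gapsP (descents a).
  by case: (gaps _) => //= j r /andP[j0 _]; rewrite n0; case: j j0.
rewrite gapsE //; have -> : cuts (descents a) = scanl addn 0%N a; last first.
  by rewrite (@scanlK _ _ _ addn) // => x y; exact: addKn.
have path_scanl x s : all (ltn 0%N) s -> path ltn x (scanl addn x s).
  by elim: s x => //= y s IHs x /andP[y0 /IHs->]; rewrite -{1}[x]addn0 ltn_add2l y0.
have last_scanl x s : last x (scanl addn x s) = (x + sumn s)%N.
  by elim: s x => [|y s IHs] x /=; rewrite ?addn0 // IHs addnA.
have le_scanl x s i : i \in scanl addn x s -> (i <= x + sumn s)%N.
  elim: s x => //= y s IHs x; rewrite inE addnA => /predU1P[->|/IHs //].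
  exact: leq_addr.
have sc := path_scanl 0%N _ a_gt0.
have n_sc : n \in scanl addn 0%N a.
  have := last_scanl 0%N a; rewrite sum_a add0n => last_a.
  suff: last 0%N (scanl addn 0%N a) \in scanl addn 0%N a by rewrite last_a.
  have : (0 < size (scanl addn 0%N a))%N.
    rewrite size_scanl lt0n size_eq0; apply: contraTneq n_gt0 => a0.
    by rewrite -sum_a /= a0.
  by case: (scanl _ _ _) => //= y s _; exact: mem_last.
apply: (irr_sorted_eq ltn_trans ltnn).
- exact: path_sorted (cuts_path _ n_gt0).
- exact: path_sorted sc.
move=> i; case: (ltngtP i n) => [lt_in|lt_ni|->].
- rewrite (mem_cuts _ (Ordinal lt_in)) inE /=.
  have [->|//] := posnP i; apply/esym/negbTE.
  have := order_path_min ltn_trans sc.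
  by apply: contraL => m0; apply/negP => /allP/(_ _ m0).
- transitivity false; last first.
    by apply/esym/negP => /le_scanl; rewrite sum_a add0n leqNgt lt_ni.
  rewrite mem_rcons inE gtn_eqF //= mem_filter mem_iota add1n prednK //.
  by rewrite (ltnNge i) (ltnW lt_ni) !andbF.
- by rewrite n_sc mem_rcons mem_head.
Qed.

Definition compl a : composition n :=
  of_descents ([set i : 'I_n | (0 < i)%N] :\: descents a).

Lemma descents_compl a :
  descents (compl a) = [set i : 'I_n | (0 < i)%N] :\: descents a.
Proof.
by rewrite of_descentsK; apply/setP => i; rewrite !inE; case: (0 < i)%N; rewrite ?andbT ?andbF.
Qed.

Definition refines a b : bool := descents b \subset descents a.

Definition cstat a b : nat := (\sum_(i in descents a :&: descents b) i)%N.

End Compositions.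

Notation "a ⪯ b" := (refines a b) (at level 70, no associativity).

Section LinearAlgebra.
Variables (K : fieldType) (V : lmodType K) (I : finType).
Implicit Types (P : pred I) (v : I -> V) (U : V -> Prop).

Definition span P v : V -> Prop :=
  fun x => exists c : I -> K, x = \sum_(i | P i) c i *: v i.

Definition lin_indep P v : Prop :=
  forall c : I -> K, \sum_(i | P i) c i *: v i = 0 -> forall i, P i -> c i = 0.

Definition basis_of_subspace U P v : Prop :=
  [/\ forall i, P i -> U (v i), lin_indep P v & forall x, U x -> span P v x].

End LinearAlgebra.

Section NoncommutativeSymmetricFunctions.
Variable R : realType.

(* C(q,t) as Frac(C[q][t]), with C = R[i]: q is the inner variable, t the *)
(* outer one.                                                             *)
Definition Cqt : fieldType := {fraction {poly {poly R[i]}}}.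

Definition q : Cqt := FracField.tofrac ('X%:P).
Definition t : Cqt := FracField.tofrac 'X.

(* The algebra of the free monoid on letters 0, 1, 2, ...; the letter i *)
(* stands for the generator h_{i+1}.                                    *)
Definition Sym : lalgType Cqt := {malg Cqt[{fmonom nat}]}.

(* only meaningful for 0 < k *)
Definition hgen (k : nat) : Sym := << fmu k.-1 >>.

Variable n : nat.
Implicit Types a b g : composition n.

Definition hcomp a : Sym := \prod_(k <- parts a) hgen k.

(* The nat subtraction is exact: a ⪯ b forces size b <= size a. *)
Definition ribbon a : Sym :=
  \sum_(b | a ⪯ b) (-1) ^+ (size a - size b) *: hcomp b.

Definition HallLittlewood a : Sym :=
  \sum_(b | a ⪯ b) t ^+ cstat a (compl b) *: ribbon b.

Definition gamma_ribbon g a : Sym :=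
  \sum_(b | (a ⪯ b) && (descents a :\: descents b \subset descents g))
     t ^+ cstat a (compl b) *: ribbon b.

Definition Sym_gamma g : Sym -> Prop := span (fun a => a ⪯ g) HallLittlewood.

End NoncommutativeSymmetricFunctions.

Arguments t {R}.
Arguments q {R}.

(* Main.v *)
(* Identify a composition with its descent set; then c(a, b^c) is the sum of
   D(a) \ D(b), hence additive along chains a ⪯ b ⪯ c. The coefficient of the
   ribbon of c in either change of basis is therefore t^c(a, c^c) times a
   combinatorial sum over b: exactly one b for H, and an alternating sum over
   the interval [D(c) ∪ D(g), D(a)], which vanishes unless its ends coincide,
   for the inverse. Independence is inherited along the triangular systems
   h -> R -> R^(g) from the monomials of the free algebra. *)
Require Import Defs.
From mathcomp Require Import all_boot all_order all_algebra.
From mathcomp Require Import reals.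
From mathcomp Require Import monalg.

Import GRing.Theory.
Local Open Scope ring_scope.

(** * Alternating sums over intervals of subsets, and linear algebra *)

(** Expand the product of [F i + G i] by distributivity: [B] selects [F] inside and [G] outside. [F]
    kills every [B] not inside [A], [G] kills every [B] missing a point of [X], and [G] gives the
    sign on [A :\: B]. The factor is 0 exactly for [i] in [A :\: X], and 1 elsewhere. *)
Lemma sum_sign_interval (K : comPzRingType) (T : finType) (X A : {set T}) :
  X \subset A ->
  \sum_(B : {set T} | (X \subset B) && (B \subset A)) (-1) ^+ #|A :\: B|
    = (X == A)%:R :> K.
Proof.
move=> sXA.
pose F i : K := (i \in A)%:R.
pose G i : K := if i \in A then - (i \notin X)%:R else 1.
transitivity (\sum_(B : {set T}) \prod_i (if i \in B then F i else G i)).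
  rewrite big_mkcond; apply: eq_bigr => B _.
  case: ifP => [/andP[sXB sBA]|nXBA].
    rewrite (bigID (mem (A :\: B))) /= [X in _ * X]big1 ?mulr1 => [|i].
      rewrite -prodr_const; apply: eq_bigr => i; rewrite inE => /andP[iB iA].
      by rewrite (negPf iB) /G iA (contra (subsetP sXB i) iB).
    rewrite inE negb_and negbK /F /G => /orP[iB|iA].
      by rewrite iB (subsetP sBA i iB).
    by rewrite (negPf iA) (contraNF (subsetP sBA i) iA).
  have [sXB|/subsetPn[i iX iB]] := boolP (X \subset B); last first.
    by rewrite (bigD1 i) //= (negPf iB) /G (subsetP sXA i iX) iX /= oppr0 mul0r.
  have /subsetPn[i iB iA] : ~~ (B \subset A) by move: nXBA; rewrite sXB /= => ->.
  by rewrite (bigD1 i) //= iB /F (negPf iA) mul0r.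
rewrite -(bigA_distr 1 (GRing.add : K -> K -> K)).
have [EXA|neXA] := eqVneq X A.
  by apply: big1 => i _; rewrite /F /G -EXA; case: (i \in X); rewrite /= ?oppr0 ?addr0 ?add0r.
have /subsetPn[i iA iX] : ~~ (A \subset X).
  by apply: contra neXA => sAX; rewrite eqEsubset sXA.
by rewrite (bigD1 i) //= /F /G iA iX /= subrr mul0r.
Qed.

Lemma lin_indep_sub (K : fieldType) (V : lmodType K) (I : finType)
    (P : pred I) (v : I -> V) : lin_indep predT v -> lin_indep P v.
Proof.
move=> v_free c; rewrite big_mkcond => c0 i Pi.
have /v_free/(_ i isT) : \sum_(i | predT i) (if P i then c i else 0) *: v i = 0.
  by rewrite -[RHS]c0; apply: eq_bigr => j _; case: ifP; rewrite ?scale0r.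
by rewrite Pi.
Qed.

(** The coefficient of [w j] in a vanishing combination involves [c j] and only [c i] with [i] of
    smaller rank, so the [c j] vanish by induction on the rank. *)
Lemma triangular_lin_indep (K : fieldType) (V : lmodType K) (I : finType)
    (E : rel I) (rk : I -> nat) (m : I -> I -> K) (v w : I -> V) :
  (forall i, E i i) -> (forall i, m i i != 0) ->
  (forall i j, E i j -> i != j -> (rk i < rk j)%N) ->
  (forall i, v i = \sum_(j | E i j) m i j *: w j) ->
  lin_indep predT w -> lin_indep predT v.
Proof.
move=> E_refl m_neq0 E_rk vE w_free c c0.
have coord0 j : \sum_(i | E i j) c i * m i j = 0.
  apply: (w_free (fun j => \sum_(i | E i j) c i * m i j)) => //; rewrite -[RHS]c0.
  transitivity (\sum_i \sum_(j | E i j) (c i * m i j) *: w j).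
    by rewrite [RHS](exchange_big_dep predT) //=; apply: eq_bigr => k _; rewrite scaler_suml.
  by apply: eq_bigr => i _; rewrite vE scaler_sumr; apply: eq_bigr => k _; rewrite scalerA.
suff main r j : (rk j < r)%N -> c j = 0 by move=> j _; exact: (main (rk j).+1).
elim: r j => // r IHr j; rewrite ltnS => le_r.
have := coord0 j; rewrite (bigD1 j) //= big1 ?addr0 => [/eqP|i /andP[Eij ij]].
  by rewrite mulf_eq0 (negPf (m_neq0 j)) orbF => /eqP.
by rewrite IHr ?mul0r //; exact: leq_trans (E_rk _ _ Eij ij) le_r.
Qed.

Lemma span_family (K : fieldType) (V : lmodType K) (I : finType)
    (P : pred I) (v w : I -> V) :
  (forall i, P i -> Defs.span P w (v i)) -> forall x, Defs.span P v x -> Defs.span P w x.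
Proof.
move=> vw x [c ->]; elim/big_rec: _ => [|i y Pi [d ->]].
  by exists (fun=> 0); rewrite big1 // => i _; rewrite scale0r.
have [e ->] := vw i Pi; exists (fun j => c i * e j + d j).
rewrite scaler_sumr -big_split; apply: eq_bigr => j _ /=.
by rewrite scalerDl scalerA.
Qed.

Lemma span_sum (K : fieldType) (V : lmodType K) (I : finType)
    (P Q : pred I) (c : I -> K) (v : I -> V) :
  Defs.span P v (\sum_(i | Q i && P i) c i *: v i).
Proof.
exists (fun i => if Q i then c i else 0).
rewrite big_mkcondl; apply: eq_bigr => i _; by case: ifP; rewrite ?scale0r.
Qed.

(** * Refinement, lengths and the statistic c in terms of descent sets *)

Lemma refines_refl n (a : composition n) : a ⪯ a.
Proof. exact: subxx. Qed.

Lemma refines_trans n (b a c : composition n) : a ⪯ b -> b ⪯ c -> a ⪯ c.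
Proof. by rewrite /refines => ab bc; exact: subset_trans bc ab. Qed.

Lemma descents_inj n : injective (@descents n).
Proof. exact: can_inj (@descentsK n). Qed.

Lemma descents_gt0 n (a : composition n) i : i \in descents a -> (0 < i)%N.
Proof. by rewrite -{1}[a]descentsK of_descentsK inE => /andP[]. Qed.

(** [of_descents] discards the index 0, which no descent set contains. *)
Lemma of_descents_subK n (a : composition n) (S : {set 'I_n}) :
  S \subset descents a -> descents (of_descents S) = S.
Proof.
move=> sSa; rewrite of_descentsK; apply/setP => i; rewrite inE andb_idr //.
by move/(subsetP sSa)/descents_gt0.
Qed.

(** The parts are the gaps between cuts, and the cuts are the descents followed by [n]. For [n = 0]
    the composition is empty and the formula fails. *)
Lemma size_composition n (a : composition n) :
  (0 < n)%N -> size a = #|descents a|.+1.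
Proof.
move=> n_gt0; rewrite -{1}[a]descentsK /= gapsE // size_pairmap size_rcons.
congr _.+1; rewrite -(size_image val); apply/perm_size/uniq_perm.
- exact/filter_uniq/iota_uniq.
- by rewrite map_inj_uniq ?enum_uniq //; exact: val_inj.
move=> i; rewrite mem_filter andb_idr // => /imageP[j /descents_gt0 j_gt0 ->].
by rewrite mem_iota j_gt0 add1n prednK // ltn_ord.
Qed.

Lemma size_refines n (a b : composition n) : a ⪯ b ->
  (size a - size b = #|descents a :\: descents b|)%N.
Proof.
move=> sba; have [n0|n_gt0] := posnP n.
  have E (c : composition n) : parts c = [::].
    case: c => [[|k s] //= /andP[/andP[k_gt0 _]]].
    by rewrite n0 addn_eq0 eqn0Ngt k_gt0.
  by rewrite !E eq_card0 // => i; have := leq_trans (ltn_ord i) (eq_leq n0).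
by rewrite !size_composition // subSS cardsDS.
Qed.

(** Complements make the rank increase towards coarser compositions, as [triangular_lin_indep]
    requires. *)
Lemma refines_rank n (a b : composition n) :
  a ⪯ b -> a != b -> (#|~: descents a| < #|~: descents b|)%N.
Proof.
rewrite /refines => ab ne; apply/proper_card; rewrite properEneq setCS ab andbT.
by rewrite (inj_eq (@setC_inj _)) (inj_eq (@descents_inj n)).
Qed.

Lemma cstat_compl n (a b : composition n) :
  cstat a (compl b) = (\sum_(i in descents a :\: descents b) i)%N.
Proof.
rewrite /cstat descents_compl setIDA (setIidPl _) //.
by apply/subsetP => i /descents_gt0; rewrite in_set.
Qed.

Lemma cstat_compl_refl n (a : composition n) : cstat a (compl a) = 0%N.
Proof. by rewrite cstat_compl setDv big_set0. Qed.

Lemma cstat_compl_trans n (a b c : composition n) : a ⪯ b -> b ⪯ c ->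
  (cstat a (compl b) + cstat b (compl c) = cstat a (compl c))%N.
Proof.
rewrite /refines !cstat_compl => sba scb.
rewrite [RHS](big_setID (descents b)) /= [RHS]addnC; congr (_ + _)%N; apply: eq_bigl => i.
  rewrite !in_setD; have [//|iB] := boolP (i \in descents b).
  by rewrite (contra (subsetP scb i) iB).
rewrite in_setI !in_setD; have [iB|] := boolP (i \in descents b); last by rewrite !andbF.
by rewrite (subsetP sba i iB) !andbT.
Qed.

(** * Linear independence of the three families *)

Lemma hcompE (R : realType) n (a : composition n) :
  hcomp R a = << FMonom [seq k.-1 | k <- parts a] >>.
Proof.
rewrite /hcomp; elim: (parts a) => [|k s IHs].
  by rewrite big_nil -fmoneE.
rewrite big_cons IHs /hgen malgM_def fgmulUU mulr1; congr << _ >>.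
by apply/eqP; rewrite fmP fmM fmU.
Qed.

(** Positivity of the parts is essential, since [0.-1 = 1.-1]. *)
Lemma map_pred_parts_inj n (a b : composition n) :
  [seq k.-1 | k <- parts a] = [seq k.-1 | k <- parts b] -> a = b.
Proof.
have predK (c : composition n) : [seq k.+1 | k <- [seq k.-1 | k <- parts c]] = c.
  have /andP[/allP c_gt0 _] := valP c.
  by rewrite -map_comp map_id_in // => k /c_gt0; exact: prednK.
by move=> E; apply: val_inj; rewrite /= -predK E predK.
Qed.

Lemma hcomp_lin_indep (R : realType) n : lin_indep predT (@hcomp R n).
Proof.
move=> c c0 a _.
(* Distinct compositions give distinct words, so this coefficient isolates [c a]. *)
have := congr1 (mcoeff (FMonom [seq k.-1 | k <- parts a])) c0.
rewrite mcoeff0 raddf_sum (bigD1 a) //= big1 ?addr0 => [|b ba].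
  by rewrite mcoeffZ hcompE mcoeffUU mulr1.
rewrite mcoeffZ hcompE mcoeffU; case: eqP => [[/map_pred_parts_inj E]|_].
  by rewrite E eqxx in ba.
by rewrite mulr0.
Qed.

Lemma ribbon_lin_indep (R : realType) n : lin_indep predT (@ribbon R n).
Proof.
apply: (triangular_lin_indep _ _ _ (@refines n) (fun a => #|~: descents a|)
  (fun a b => (-1) ^+ (size a - size b))) (@hcomp_lin_indep R n) => //.
- exact: refines_refl.
- by move=> a; rewrite subnn oner_eq0.
- exact: refines_rank.
Qed.

(** Unitriangular over the ribbons: the diagonal coefficient is [t ^+ 0 = 1]. *)
Lemma gamma_ribbon_lin_indep (R : realType) n (g : composition n) :
  lin_indep predT (@gamma_ribbon R n g).
Proof.
apply: (triangular_lin_indep _ _ _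
  (fun a b => (a ⪯ b) && (descents a :\: descents b \subset descents g))
  (fun a => #|~: descents a|) (fun a b => t ^+ cstat a (compl b)))
  (@ribbon_lin_indep R n) => //.
- by move=> a; rewrite refines_refl setDv sub0set.
- by move=> a; rewrite cstat_compl_refl oner_eq0.
- by move=> a b /andP[ab _]; exact: refines_rank.
Qed.

(** * The two changes of basis *)

(* Given [c], the only [b] with [b ⪯ g] that contributes [ribbon c] is the one
   with descent set [D(c) ∪ D(g)]. *)
Lemma HallLittlewood_gamma_ribbon (R : realType) n (g a : composition n) :
  a ⪯ g ->
  HallLittlewood R a =
    \sum_(b | (a ⪯ b) && (b ⪯ g)) t ^+ cstat a (compl b) *: gamma_ribbon R g b.
Proof.
move=> ag; under [RHS]eq_bigr => b _.
  by rewrite scaler_sumr; under eq_bigr => c _ do rewrite scalerA -exprD; over.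
rewrite [RHS](exchange_big_dep (fun c => a ⪯ c)) /=; last first.
  by move=> b c /andP[ab _] /andP[bc _]; exact: refines_trans bc.
apply: eq_bigr => c ac.
have sDa : descents c :|: descents g \subset descents a by rewrite subUset; apply/andP.
rewrite (big_pred1 (of_descents (descents c :|: descents g))) => [|b].
  have DE := of_descents_subK _ _ _ sDa.
  by rewrite cstat_compl_trans // /refines DE // subsetUl.
rewrite /= -(inj_eq (@descents_inj n)) (of_descents_subK _ _ _ sDa) eqEsubset.
(* [b ⪯ c] and [b ⪯ g] say that D(b) contains the union, and the condition in [gamma_ribbon] says
   that it is contained in it; [a ⪯ b] then follows. *)
rewrite /refines subUset subDset.
apply/idP/idP => [/andP[/andP[_ ->] /andP[-> ->]] //|/and3P[bU -> ->]].
by rewrite bU !andbT (subset_trans bU).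
Qed.

Lemma sum_sign_refines (K : comPzRingType) n (a c g : composition n) :
  a ⪯ c -> a ⪯ g ->
  \sum_(b | [&& a ⪯ b, b ⪯ g & b ⪯ c]) (-1) ^+ (size a - size b)
    = (descents a :\: descents c \subset descents g)%:R :> K.
Proof.
rewrite /refines => ac ag.
have sXa : descents c :|: descents g \subset descents a by rewrite subUset; apply/andP.
have -> : (descents a :\: descents c \subset descents g)
    = (descents c :|: descents g == descents a).
  by rewrite eqEsubset sXa subDset.
(* Every set in the interval lies inside D(a), hence is the descent set of a composition. *)
rewrite -sum_sign_interval // (reindex_onto (@descents n) (@of_descents n)).
  apply: eq_big => [b|b /and3P[ab _ _]]; last by rewrite size_refines.
  by rewrite descentsK eqxx andbT subUset andbC [(descents c \subset _) && _]andbC.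
by move=> S /andP[_]; exact: of_descents_subK.
Qed.

(** The alternating sum in front of [ribbon R c] is the indicator of the condition that defines
    [gamma_ribbon]. *)
Lemma gamma_ribbon_HallLittlewood (R : realType) n (g a : composition n) :
  a ⪯ g ->
  gamma_ribbon R g a =
    \sum_(b | (a ⪯ b) && (b ⪯ g))
      ((-1) ^+ (size a - size b) * t ^+ cstat a (compl b)) *: HallLittlewood R b.
Proof.
move=> ag; under [RHS]eq_bigr => b _.
  by rewrite scaler_sumr; under eq_bigr => c _ do rewrite scalerA -mulrA -exprD; over.
rewrite [RHS](exchange_big_dep (fun c => a ⪯ c)) /=; last first.
  by move=> b c /andP[ab _]; exact: refines_trans.
rewrite [LHS]big_mkcondr; apply: eq_bigr => c ac.
transitivity ((descents a :\: descents c \subset descents g)%:R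
    *: (t ^+ cstat a (compl c) *: ribbon R c)).
  by rewrite scaler_nat mulrb.
rewrite -sum_sign_refines // scaler_suml; apply: eq_big => [b|b /and3P[ab _ bc]].
  by rewrite andbA.
by rewrite scalerA cstat_compl_trans.
Qed.

Theorem theorem9 (R : realType) (n : nat) (gamma : composition n) :
  [/\ basis_of_subspace (@Sym_gamma R n gamma)
        (fun alpha => alpha ⪯ gamma) (@gamma_ribbon R n gamma),
      forall alpha : composition n, alpha ⪯ gamma ->
        HallLittlewood R alpha =
          \sum_(beta : composition n | (alpha ⪯ beta) && (beta ⪯ gamma))
             t ^+ cstat alpha (compl beta) *: gamma_ribbon R gamma beta
    & forall alpha : composition n, alpha ⪯ gamma ->
        gamma_ribbon R gamma alpha =
          \sum_(beta : composition n | (alpha ⪯ beta) && (beta ⪯ gamma))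
             ((-1) ^+ (size alpha - size beta) * t ^+ cstat alpha (compl beta))
               *: HallLittlewood R beta].
Proof.
split; [split| |].
- by move=> a ag; rewrite gamma_ribbon_HallLittlewood //; exact: span_sum.
- exact/lin_indep_sub/gamma_ribbon_lin_indep.
(* The direct formula gives spanning; the inverse one gave membership above. *)
- apply: span_family => a ag; rewrite (HallLittlewood_gamma_ribbon _ _ gamma) //.
  exact: span_sum.
- exact: HallLittlewood_gamma_ribbon.
- exact: gamma_ribbon_HallLittlewood.
Qed.
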